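(* The von Neumann algebra $\mathcal{SC}=W^*(\{S_t,t\ge0\})$ generated by a free Brownian motion is a factor, i.e. its center is $\mathbb{C}\cdot1$.
   Context: On the full Fock space $\mathbb{C}\Omega\oplus\bigoplus_{n\ge1}L^2(\mathbb{R}_+)^{\otimes n}$ (complex $L^2$, $\|\Omega\|=1$), let $l(h)$ be the left creation operator, $l(h)\Omega=h$, $l(h)(g_1\otimes\cdots\otimes g_n)=h\otimes g_1\otimes\cdots\otimes g_n$, and for real-valued $h\in L^2_{\mathbb{R}}(\mathbb{R}_+)$ let $S(h)=l(h)+l(h)^*$. The free Brownian motion is $S_t=S(\mathbf{1}_{[0,t]})$, $t\ge0$, and $W^*(\{S_t,t\ge0\})$ is the von Neumann algebra of operators on the Fock space generated by it, equivalently by $\{S(h):h\in L^2_{\mathbb{R}}(\mathbb{R}_+)\}$. *)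

(* Defs.v *)
(* The field of complex numbers is [R[i]] for [R : realType]. *)
From HB Require Import structures.
From mathcomp Require Import all_boot all_order all_algebra sesquilinear.
From mathcomp Require Import complex.
From mathcomp Require Import all_classical all_reals all_analysis.

Set Implicit Arguments.
Unset Strict Implicit.
Unset Printing Implicit Defensive.

Import Order.TTheory GRing.Theory Num.Theory.
Import numFieldNormedType.Exports.

Local Open Scope classical_set_scope.
Local Open Scope complex_scope.
Local Open Scope ring_scope.

Section SquareIntegrable.
Variable R : realType.

Local Notation mu := (@lebesgue_measure R).

Definition halfline : set R := `[0, +oo[.

(* Functions are total on [R], but only their values on the half-line are ever
   looked at. *)
Definition square_integrable (f : R -> R[i]) : Prop :=
  [/\ measurable_fun halfline (fun x => complex.Re (f x)),
      measurable_fun halfline (fun x => complex.Im (f x)) &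
      mu.-integrable halfline
        (fun x => (complex.Re (f x) ^+ 2 + complex.Im (f x) ^+ 2)%:E)].

(* Almost everywhere equal functions are not identified at this stage. *)
Definition L2 := {f : R -> R[i] | square_integrable f}.

Definition L2_ip (f g : L2) : R[i] :=
  (\int[mu]_(x in halfline) complex.Re (sval f x * (sval g x)^*%C)) +i*
  (\int[mu]_(x in halfline) complex.Im (sval f x * (sval g x)^*%C)).

Definition interval_fun (t : R) (x : R) : R[i] := (\1_`[0, t] x)%:C.

Lemma square_integrable_interval (t : R) : square_integrable (interval_fun t).
Proof.
split => /=.
- exact: measurable_realfun.measurable_indic (measurable_itv _).
- exact: measurable_cst.
- have -> : (fun x => (complex.Re (interval_fun t x) ^+ 2 +
      complex.Im (interval_fun t x) ^+ 2)%:E) = EFin \o (\1_`[0, t] : R -> R).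
    apply: boolp.funext => x /=.
    by rewrite expr0n addr0 indicE; case: (_ \in _); rewrite ?expr1n ?expr0n.
  apply: (@integrableS _ _ R mu setT) => //; first exact: measurable_itv.
  exact: integrable_indic_itv.
Qed.

Definition interval_L2 (t : R) : L2 :=
  exist _ (interval_fun t) (square_integrable_interval t).

End SquareIntegrable.

(* Inner products are linear in the first argument and conjugate-linear in the
   second one. *)
Section OperatorAlgebras.
Variables (R : realType) (H : completeNormedModType R[i]).
Variable ip : {dot H for Num.conj}.

Definition hilbert_norm : Prop := forall x : H, `|x| ^+ 2 = ip x x.

Definition bounded_operator (A : H -> H) : Prop :=
  linear A /\ exists M : R[i], forall x, `|A x| <= M * `|x|.

Definition adjoint (A B : H -> H) : Prop :=
  forall x y, ip (A x) y = ip x (B y).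

(* Closed in the space of all bounded operators for the weak operator
   topology. *)
Definition weakly_closed (M : set (H -> H)) : Prop :=
  forall A, bounded_operator A ->
    (forall (n : nat) (x y : 'I_n -> H) (e : R), 0 < e ->
       exists2 B, M B & forall i, `|ip (A (x i)) (y i) - ip (B (x i)) (y i)| < e%:C) ->
    M A.

Record von_neumann_algebra (M : set (H -> H)) : Prop := {
  vna_bounded : forall A, M A -> bounded_operator A;
  vna_id : M id;
  vna_add : forall A B, M A -> M B -> M (fun x => A x + B x);
  vna_scale : forall (c : R[i]) A, M A -> M (fun x => c *: A x);
  vna_comp : forall A B, M A -> M B -> M (A \o B);
  vna_adjoint : forall A B, bounded_operator B -> adjoint A B -> M A -> M B;
  vna_closed : weakly_closed M
}.

Definition generated_vna (X : set (H -> H)) : set (H -> H) :=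
  \bigcap_(M in [set M | von_neumann_algebra M /\ X `<=` M]) M.

Definition vna_center (M : set (H -> H)) : set (H -> H) :=
  [set Z | M Z /\ forall A, M A -> Z \o A = A \o Z].

Definition scalar_operators : set (H -> H) :=
  [set A | exists c : R[i], A = (fun x => c *: x)].

Definition is_factor (M : set (H -> H)) : Prop :=
  von_neumann_algebra M /\ vna_center M = scalar_operators.

End OperatorAlgebras.

Section FockSpace.
Variables (R : realType) (H : completeNormedModType R[i]).
Variable ip : {dot H for Num.conj}.

(* [tens [:: g_1; ...; g_n]] is the elementary tensor g_1 (x) ... (x) g_n, and
   [tens [::]] is the vacuum vector.  Since the Hilbert space tensor power
   L^2(R_+)^{(x) n} is the completion of the span of the elementary tensors for
   the product inner product, and the summands of distinct degrees are
   orthogonal, these clauses determine [(H, ip, tens)] up to a unique unitary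
   isomorphism.  Multilinearity of [tens], and its invariance under almost
   everywhere equality, follow from [fock_ip]. *)
Record full_fock_space (tens : seq (L2 R) -> H) : Prop := {
  fock_hilbert : hilbert_norm ip;
  fock_ip : forall g h : seq (L2 R),
    ip (tens g) (tens h) =
      if size g == size h then \prod_(p <- zip g h) L2_ip p.1 p.2 else 0;
  fock_dense :
    closure [set x : H | exists (n : nat) (c : 'I_n -> R[i])
                                (g : 'I_n -> seq (L2 R)),
                         x = \sum_(i < n) c i *: tens (g i)] = setT
}.

(* Density of the span makes the operators [l], [l'] and [S] below unique. *)
Definition left_creation (tens : seq (L2 R) -> H) (h : L2 R) (l : H -> H) : Prop :=
  bounded_operator l /\ forall g, l (tens g) = tens (h :: g).

Definition field_operator (tens : seq (L2 R) -> H) (h : L2 R) (S : H -> H) : Prop :=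
  exists l l' : H -> H,
    [/\ left_creation tens h l, bounded_operator l', adjoint ip l l' &
        S = (fun x => l x + l' x)].

Definition free_brownian_motion (tens : seq (L2 R) -> H) (S : R -> H -> H) : Prop :=
  forall t, 0 <= t -> field_operator tens (interval_L2 t) (S t).

End FockSpace.

(* Main.v *)
(* Let U be the flip unitary g_1 (x) ... (x) g_n |-> g_n (x) ... (x) g_1.  The
   right-handed field operators U S_t U commute with all the S_s, hence with the
   generated algebra, because l_s^* r_t = r_t l_s^* + min(s,t) P where r_t = U l_t U
   and P is the projection onto the vacuum.  If Z is central, then xi = Z vac
   satisfies S_t xi = U S_t U xi for all t.  Take the differences of this
   equation between t = n and t = n + 1: with L_n, R_n the left and right creation
   operators of the unit vector h_n = 1_]n, n+1] it reads
   (L_n + L_n^* ) xi = (R_n + R_n^* ) xi, and applying L_n^* yields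
     xi - P xi = R_n L_n^* xi + L_n^* R_n^* xi - L_n^* L_n^* xi.
   The h_n are orthonormal, so L_n^* and R_n^* tend strongly to 0 and
   xi = P xi = c vac.  Then U (Z - c) U kills the vacuum and commutes with the S_t;
   it vanishes since the vacuum is cyclic for the S_t, by density of the
   indicators of the intervals [0, t] in L^2. *)
Require Import Defs.
From mathcomp Require Import all_boot all_order all_algebra sesquilinear.
From mathcomp Require Import complex ring lra zify.
From mathcomp Require Import all_classical all_reals all_analysis.
From mathcomp Require Import measurable_realfun.
Import Order.TTheory GRing.Theory Num.Theory.
Import numFieldNormedType.Exports.
Local Open Scope classical_set_scope.
Local Open Scope complex_scope.
Local Open Scope ring_scope.

Set Implicit Arguments.
Unset Strict Implicit.
Unset Printing Implicit Defensive.

(** * Linearity of bare functions *)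

Section LinearMap.
Variables (K : pzRingType) (U V : lmodType K) (A : U -> V).
Hypothesis linA : linear A.

Lemma lin0 : A 0 = 0.
Proof.
by have := linA (-1) 0 0; rewrite scaleN1r addr0 oppr0 scaleN1r addNr.
Qed.

Lemma linD x y : A (x + y) = A x + A y.
Proof. by have := linA 1 x y; rewrite !scale1r. Qed.

Lemma linZ a x : A (a *: x) = a *: A x.
Proof. by have := linA a x 0; rewrite lin0 !addr0. Qed.

Lemma linB x y : A (x - y) = A x - A y.
Proof. by rewrite -scaleN1r linD linZ scaleN1r. Qed.

End LinearMap.

(** * Hilbert space geometry and bounded operators *)

Section InnerProduct.
Variables (R : realType) (H : completeNormedModType R[i]).
Variable ip : {dot H for Num.conj}.
Local Notation C := R[i].

Lemma ipC x y : ip x y = (ip y x)^*%R.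
Proof. by rewrite hermC expr0 mul1r. Qed.

Lemma ipZr a x y : ip x (a *: y) = a^*%R * ip x y.
Proof. exact: linearZr_LR. Qed.

Lemma ipZl a x y : ip (a *: x) y = a * ip x y.
Proof. exact: linearZl_LR. Qed.

Hypothesis normE : hilbert_norm ip.

Lemma cauchy_schwarz x y : `|ip x y| <= `|x| * `|y|.
Proof.
have [->|y0] := eqVneq y 0; first by rewrite linear0r !normr0 mulr0.
have yy0 : ip y y != 0 by rewrite dnorm_eq0.
rewrite -(@ler_pXn2r _ 2) ?nnegrE ?mulr_ge0// exprMn !normE.
(* [a *: y] is the orthogonal projection of [x] onto the line of [y]. *)
pose a := ip x y / ip y y.
have := dnorm_ge0 ip (x - a *: y).
rewrite dnormB dnormZ ipZr [a^*%R * _]mulrC.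
have -> : (ip x y * a^*%R)^*%R = ip x y * a^*%R.
  rewrite rmorphM/= conjCK /a rmorphM/= fmorphV/= -(ipC y y).
  by rewrite mulrCA !mulrA.
have -> : `|a| ^+ 2 * ip y y = ip x y * a^*%R.
  rewrite normCK mulrAC mulrC /a -mulrA mulVf// mulr1.
  by rewrite mulrC.
rewrite opprD addrA addrK subr_ge0.
rewrite /a rmorphM/= fmorphV/= -(ipC y y) mulrA -normCK.
by rewrite ler_pdivrMr// lt_def yy0 dnorm_ge0.
Qed.

(** If [x] were nonzero, [e = 1] would force [M > 0], and then [e = |x| / 2M] would give
    [|x| <= |x| / 2]. Most limiting arguments below end with this lemma. *)
Lemma small_eq0 (V : normedZmodType C) (M : C) (x : V) :
  (forall e, 0 < e -> `|x| <= M * e) -> x = 0.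
Proof.
move=> xe; apply/eqP; rewrite -normr_eq0; apply/negPn/negP => x0.
have x1 : 0 < `|x| by rewrite lt_def x0 normr_ge0.
have M0 : 0 < M.
  by have := xe 1 ltr01; rewrite mulr1; apply: lt_le_trans.
have e0 : 0 < `|x| / (M + M) by rewrite divr_gt0// addr_gt0.
have := xe _ e0; rewrite mulrC -mulrA.
have -> : (M + M)^-1 * M = 2^-1.
  by rewrite -mulr2n -[M *+ 2]mulr_natr invfM mulrAC mulVf ?mul1r// gt_eqF.
rewrite ler_pdivlMr// ger_pMr//.
by rewrite (ler_nat _ 2 1).
Qed.

(** A positive complex number is real in the order of [R[i]], so the Archimedean property of [R]
    applies to its real part. *)
Lemma archimedean_complex (e : C) :
  0 < e -> exists N, forall n, (N <= n)%N -> n.+1%:R^-1 < e.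
Proof.
move=> e0; have := e0; rewrite ltcE => /andP[/eqP Ie Re].
have eE : e = (complex.Re e)%:C by case: e Ie {e0 Re} => a b /= ->.
have := near_infty_natSinv_lt (PosNum Re) => -[N _ NP]; exists N => n /NP /=.
rewrite eE -ltcR; apply: le_lt_trans.
by rewrite fmorphV rmorph_nat.
Qed.

(** Linear properties stable under norm limits are put in this form, so that checking them on a
    total family suffices. Closedness is phrased by approximation, ready for epsilon arguments. *)
Record closed_submodule (K : set H) : Prop := {
  closed_submodule0 : K 0;
  closed_submoduleP : forall a x y, K x -> K y -> K (a *: x + y);
  closed_submodule_lim : forall x,
    (forall e, 0 < e -> exists2 v, K v & `|x - v| < e) -> K x
}.

Lemma closed_submoduleZ K a x : closed_submodule K -> K x -> K (a *: x).
Proof.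
by move=> KP Kx; rewrite -[_ *: _]addr0; apply: closed_submoduleP => //; case: KP.
Qed.

Lemma closed_submoduleD K x y : closed_submodule K -> K x -> K y -> K (x + y).
Proof.
by move=> KP Kx Ky; rewrite -[x]scale1r; apply: closed_submoduleP.
Qed.

(** The codomain is left general to cover both bounded operators and the functionals [ip _ y]. *)
Lemma lipschitz_ker_closed (V : normedZmodType C) (f : H -> V) (M : C) :
  f 0 = 0 -> (forall a x y, f x = 0 -> f y = 0 -> f (a *: x + y) = 0) ->
  (forall x y, `|f x - f y| <= M * `|x - y|) ->
  closed_submodule [set x | f x = 0].
Proof.
move=> f0 fP fM; split => //= x xK; apply: (@small_eq0 _ `|M|) => e e0.
have [v /= fv xv] := xK e e0.
have := fM x v; rewrite fv subr0 => fx.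
have : M * `|x - v| <= `|M| * e.
  have M0 : 0 <= M * `|x - v| by rewrite (le_trans _ fx).
  by rewrite -(ger0_norm M0) normrM normr_id ler_wpM2l// ltW.
exact: le_trans.
Qed.

Lemma bounded_operatorP (A : H -> H) : bounded_operator A ->
  linear A /\ exists2 M : C, 0 <= M & forall x, `|A x| <= M * `|x|.
Proof.
move=> [linA [M MP]]; split => //; exists `|M| => // x.
have Mx : 0 <= M * `|x| by rewrite (le_trans _ (MP x)).
by rewrite (le_trans (MP x))// -[leLHS](ger0_norm Mx) normrM normr_id.
Qed.

Lemma bounded_id : bounded_operator (@id H).
Proof. by split => //; exists 1 => x; rewrite mul1r. Qed.

Lemma bounded_comp (A B : H -> H) : bounded_operator A -> bounded_operator B ->
  bounded_operator (fun x => A (B x)).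
Proof.
move=> /bounded_operatorP[linA [M M0 AM]] /bounded_operatorP[linB [N N0 BN]].
split; first by move=> a x y; rewrite linB linA.
exists (M * N) => x; rewrite (le_trans (AM _))// -mulrA ler_wpM2l//.
Qed.

Lemma bounded_add (A B : H -> H) : bounded_operator A -> bounded_operator B ->
  bounded_operator (fun x => A x + B x).
Proof.
move=> /bounded_operatorP[linA [M M0 AM]] /bounded_operatorP[linB [N N0 BN]].
split; first by move=> a x y; rewrite linB linA scalerDr addrACA.
exists (M + N) => x; rewrite (le_trans (ler_normD _ _))// mulrDl lerD//.
Qed.

Lemma bounded_scale a (A : H -> H) : bounded_operator A ->
  bounded_operator (fun x => a *: A x).
Proof.
move=> /bounded_operatorP[linA [M M0 AM]].
split; first by move=> b x y; rewrite linA scalerDr !scalerA mulrC.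
by exists (`|a| * M) => x; rewrite normrZ -mulrA ler_wpM2l.
Qed.

Lemma bounded_sub (A B : H -> H) : bounded_operator A -> bounded_operator B ->
  bounded_operator (fun x => A x - B x).
Proof.
move=> bA bB; have := bounded_add bA (bounded_scale (-1) bB).
by congr bounded_operator; apply: boolp.funext => x; rewrite scaleN1r.
Qed.

Lemma bounded_rank1 v : bounded_operator (fun x => ip x v *: v).
Proof.
split; first by move=> a x y; rewrite linearDl/= ipZl scalerDl scalerA.
exists (`|v| * `|v|) => x; rewrite normrZ.
by rewrite mulrAC ler_wpM2r// mulrC cauchy_schwarz.
Qed.

Lemma bounded_ker_closed (A : H -> H) : bounded_operator A ->
  closed_submodule [set x | A x = 0].
Proof.
move=> [linA [M AM]]; apply: (@lipschitz_ker_closed _ _ M).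
- exact: lin0.
- by move=> a x y Ax Ay; rewrite linA Ax Ay addr0 scaler0.
- by move=> x y; rewrite -linB.
Qed.

(** Polarization: the norm of [V (x + y)] determines the real part of the inner product, and
    replacing [x] by [i x] gives the imaginary part. *)
Lemma isometry_ip (V : H -> H) : linear V -> (forall x, `|V x| = `|x|) ->
  forall x y, ip (V x) (V y) = ip x y.
Proof.
move=> linV V1.
have VV z : ip (V z) (V z) = ip z z by rewrite -!normE V1.
have real_part x y : ip (V x) (V y) + (ip (V x) (V y))^*%R = ip x y + (ip x y)^*%R.
  have := VV (x + y); rewrite (linD linV) !dnormD/= !VV.
  exact: addrI.
move=> x y; have := real_part ('i%R *: x) y; have := real_part x y.
rewrite (linZ linV) !ipZl !rmorphM/= conjCi !mulNr -!mulrBr => Re_eq.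
move=> /(mulfI (neq0Ci _)) Im_eq.
have dbl (d : C) : d *+ 2 = (d + d^*%R) + (d - d^*%R).
  by rewrite addrACA subrr addr0 mulr2n.
have : ip (V x) (V y) *+ 2 = ip x y *+ 2 by rewrite !dbl Re_eq Im_eq.
by move=> /eqP; rewrite eqrMn2r => /eqP.
Qed.

(** Here [A B] is an orthogonal projection, and the squared norm of [x - A (B x)] is that of [x]
    minus that of [B x]. *)
Lemma contraction_adjoint (A B : H -> H) : adjoint ip A B ->
  (forall x, B (A x) = x) -> forall x, `|B x| <= `|x|.
Proof.
move=> AB BA x; rewrite -(@ler_pXn2r _ 2) ?nnegrE// !normE.
have := dnorm_ge0 ip (x - A (B x)).
rewrite dnormB/= AB BA (ipC x (A _)) AB -!(ipC (B x)).
by rewrite opprD addrA addrK subr_ge0.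
Qed.

End InnerProduct.

(** * Bessel's inequality for orthonormal sequences *)

Section Bessel.
Variables (R : realType) (H : completeNormedModType R[i]).
Variable ip : {dot H for Num.conj}.
Variable v : nat -> H.
Hypothesis v_orthonormal : forall i j, ip (v i) (v j) = (i == j)%:R.

Lemma bessel x n : \sum_(i < n) `|ip x (v i)| ^+ 2 <= ip x x.
Proof.
pose s m := \sum_(i < m) ip x (v i) *: v i.
have sv m j : (j < m)%N -> ip (s m) (v j) = ip x (v j).
  move=> jm; rewrite /s linear_sumlz (bigD1 (Ordinal jm))//= ipZl.
  rewrite v_orthonormal eqxx mulr1 big1 ?addr0// => i ij.
  by rewrite ipZl v_orthonormal -val_eqE /= in ij *; rewrite (negPf ij) mulr0.
have ss m : ip (s m) (s m) = \sum_(i < m) `|ip x (v i)| ^+ 2.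
  rewrite {2}/s linear_sumr; apply: eq_bigr => i _ /=.
  by rewrite ipZr sv// normCKC.
have xs m : ip x (s m) = \sum_(i < m) `|ip x (v i)| ^+ 2.
  rewrite {1}/s linear_sumr; apply: eq_bigr => i _ /=.
  by rewrite ipZr normCKC.
have := dnorm_ge0 ip (x - s n); rewrite dnormB xs -ss.
by rewrite -(ipC ip (s n)) opprD addrA addrK subr_ge0 ss.
Qed.

(** Bessel's inequality bounds the partial sums of the squared coefficients, so the series converges
    and its terms tend to 0. The series is moved to [R], where bounded monotone sequences
    converge. *)
Lemma orthonormal_weak0 x e : 0 < e ->
  exists N, forall n, (N <= n)%N -> `|ip x (v n)| < e.
Proof.
move=> e0; pose u n := complex.Re (`|ip x (v n)| ^+ 2).
have uE n : (u n)%:C = `|ip x (v n)| ^+ 2.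
  by rewrite /u RRe_real// rpredX// realE normr_ge0.
have u0 n : 0 <= u n by rewrite -lecR uE exprn_ge0.
have e2 : 0 < complex.Re (e ^+ 2).
  by have := exprn_gt0 2 e0; rewrite ltcE => /andP[].
have eE : (complex.Re (e ^+ 2))%:C = e ^+ 2.
  by rewrite RRe_real// rpredX// realE ltW.
have : cvgn (series u).
  apply: nondecreasing_is_cvgn.
    apply/nondecreasing_seqP => n.
    by rewrite !seriesEord/= big_ord_recr/= lerDl.
  exists (complex.Re (ip x x)) => _ [n _ <-].
  have := bessel x n; rewrite lecE => /andP[_]; apply: le_trans.
  by rewrite seriesEord/= raddf_sum.
move=> /cvg_series_cvg_0 /cvgr0Pnorm_lt /(_ _ e2)[N _ NP].
exists N => n /NP /=; rewrite ger0_norm// -ltcR uE eE.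
by rewrite ltr_pXn2r ?nnegrE// ltW.
Qed.

End Bessel.

(** * Extension of an inner product preserving map from a total family *)

Section IsometricExtension.
Variables (R : realType) (H : completeNormedModType R[i]).
Variable ip : {dot H for Num.conj}.
Hypothesis normE : hilbert_norm ip.
Local Notation C := R[i].
Variables (T : Type) (phi psi : T -> H).
Hypothesis ip_psi : forall s t, ip (psi s) (psi t) = ip (phi s) (phi t).
Hypothesis phi_dense : closure [set x : H | exists (n : nat) (c : 'I_n -> C)
  (g : 'I_n -> T), x = \sum_(i < n) c i *: phi (g i)] = setT.

(** The graph of the future isometry on the span of [phi]. It is a relation because a vector may be
    a combination of the [phi t] in several ways. *)
Inductive span_pair : H -> H -> Prop :=
| span_pair0 : span_pair 0 0
| span_pairD c t v w : span_pair v w ->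
    span_pair (c *: phi t + v) (c *: psi t + w).

Lemma span_pair_add v w v' w' : span_pair v w -> span_pair v' w' ->
  span_pair (v + v') (w + w').
Proof.
move=> vw vw'; elim: vw => [|c t x y _ IH]; first by rewrite !add0r.
by rewrite -!addrA; apply: span_pairD.
Qed.

Lemma span_pairZ a v w : span_pair v w -> span_pair (a *: v) (a *: w).
Proof.
elim=> [|c t x y _ IH]; first by rewrite !scaler0; exact: span_pair0.
by rewrite !scalerDr !scalerA; apply: span_pairD.
Qed.

Lemma span_pair_ip v w v' w' : span_pair v w -> span_pair v' w' ->
  ip w w' = ip v v'.
Proof.
move=> vw vw'.
have vt t : ip w (psi t) = ip v (phi t).
  elim: vw => [|c s x y _ IH]; first by rewrite !linear0l.
  by rewrite !linearDl/= !ipZl IH ip_psi.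
elim: vw' => [|c s x y _ IH]; first by rewrite !linear0r.
by rewrite !linearDr/= !ipZr IH vt.
Qed.

Lemma span_pair_norm v w : span_pair v w -> `|w| = `|v|.
Proof.
move=> vw; apply/eqP; rewrite -(@eqrXn2 _ 2)// !normE.
by rewrite (span_pair_ip vw vw).
Qed.

Lemma span_pair_sum n (c : 'I_n -> C) (g : 'I_n -> T) :
  exists w, span_pair (\sum_(i < n) c i *: phi (g i)) w.
Proof.
elim: n c g => [|n IH] c g; first by rewrite big_ord0; exists 0; exact: span_pair0.
have [w wP] := IH (fun i => c (lift ord0 i)) (fun i => g (lift ord0 i)).
by rewrite big_ord_recl; eexists; apply: span_pairD; exact: wP.
Qed.

Lemma span_pair_approx x e : 0 < e ->
  exists v w, span_pair v w /\ `|x - v| < e.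
Proof.
move=> e0; have : [set: H] x by [].
rewrite -phi_dense => /(_ _ (nbhsx_ballx x e e0)) [v [[n [c [g ->]]]]].
rewrite -ball_normE /= => xv.
have [w wP] := span_pair_sum c g.
by exists (\sum_(i < n) c i *: phi (g i)), w.
Qed.

(** The closure of the graph, which is the graph of the extension. *)
Definition limit_pair x y := forall e : C, 0 < e ->
  exists v w, [/\ span_pair v w, `|x - v| < e & `|y - w| < e].

Lemma limit_pair_lin a x y x' y' : limit_pair x y -> limit_pair x' y' ->
  limit_pair (a *: x + x') (a *: y + y').
Proof.
move=> xy xy' e e0.
(* The added 1 keeps the divisor positive when [a] is 0. *)
have d0 : 0 < `|a| + 1 by rewrite ltr_wpDl.
have e2 : 0 < e / 2 by rewrite divr_gt0.
have ea : 0 < e / 2 / (`|a| + 1) by rewrite divr_gt0.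
have [v [w [vw xv yw]]] := xy _ ea.
have [v' [w' [vw' xv' yw']]] := xy' _ e2.
have key z u z' u' : `|z - u| < e / 2 / (`|a| + 1) -> `|z' - u'| < e / 2 ->
    `|a *: z + z' - (a *: u + u')| < e.
  move=> zu zu'; rewrite opprD addrACA -scalerBr (le_lt_trans (ler_normD _ _))//.
  rewrite [ltRHS]splitr ler_ltD// normrZ.
  rewrite ltr_pdivlMr// in zu.
  rewrite (le_trans _ (ltW zu))// mulrC ler_wpM2l// lerDl//.
exists (a *: v + v'), (a *: w + w'); split; [|exact: key|exact: key].
exact: span_pair_add (span_pairZ _ _) _.
Qed.

Lemma limit_pair_norm x y : limit_pair x y -> `|y| = `|x|.
Proof.
move=> xy; apply/eqP; rewrite -subr_eq0; apply/eqP.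
apply: (@small_eq0 _ _ 2) => e e0; have [v [w [vw xv yw]]] := xy _ e0.
have -> : `|y| - `|x| = (`|y| - `|w|) + (`|v| - `|x|).
  by rewrite (span_pair_norm vw) addrA subrK.
rewrite mulr2n mulrDl !mul1r (le_trans (ler_normD _ _))// lerD//.
  exact: le_trans (ler_dist_dist _ _) (ltW yw).
by rewrite distrC (le_trans (ler_dist_dist _ _))// ltW.
Qed.

(** Vectors [v n] of the span approach [x]; their partners [w n] have the same mutual distances,
    hence form a Cauchy sequence, and completeness provides [y]. *)
Lemma limit_pair_ex x : exists y, limit_pair x y.
Proof.
have /choice[v /choice[w vwP]] : forall n, exists v w,
    span_pair v w /\ `|x - v| < n.+1%:R^-1.
  by move=> n; apply: span_pair_approx; rewrite invr_gt0.
have wc : cvg (w @ \oo).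
  apply/cauchy_cvgP/cauchy_exP => e e0; rewrite /= in e0 *.
  have e2 : 0 < e / 2 by rewrite divr_gt0.
  have [N NP] := archimedean_complex e2.
  exists (w N); exists N => // n /= Nn; rewrite -ball_normE /=.
  have [vwN xN] := vwP N; have [vwn xn] := vwP n.
  have := span_pair_add vwN (span_pairZ (-1) vwn).
  move=> /span_pair_norm; rewrite !scaleN1r => ->.
  rewrite (le_lt_trans (ler_distD x _ _))// [ltRHS]splitr [`|_ - x|]distrC.
  by rewrite ltrD// ?(lt_trans xN (NP _ _))// (lt_trans xn (NP _ _)).
exists (lim (w @ \oo)) => e e0.
have [N NP] := archimedean_complex e0.
have /cvgrPdist_lt /(_ e e0)[M _ MP] := wc.
exists (v (maxn M N)), (w (maxn M N)); have [? xv] := vwP (maxn M N).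
split => //; first exact: lt_trans xv (NP _ (leq_maxr _ _)).
exact: MP (leq_maxl _ _).
Qed.

Lemma isometric_extension : exists V : H -> H,
  [/\ linear V, forall x, `|V x| = `|x| & forall t, V (phi t) = psi t].
Proof.
have /choice[V VP] := limit_pair_ex.
(* The difference of two limit pairs over [x] is a limit pair over 0, and such pairs preserve the
   norm. *)
have uniq x y : limit_pair x y -> V x = y.
  move=> xy; apply/eqP; rewrite -subr_eq0 -normr_eq0.
  have := limit_pair_lin (-1) xy (VP x).
  by move=> /limit_pair_norm; rewrite !scaleN1r addNr normr0 addrC => ->.
exists V; split.
- by move=> a x y; apply: uniq; apply: limit_pair_lin.
- by move=> x; exact: limit_pair_norm.
- move=> t; apply: uniq => e e0; exists (phi t), (psi t); split.
  + rewrite -[phi t]scale1r -[psi t]scale1r -[_ *: phi t]addr0.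
    by rewrite -[_ *: psi t]addr0; apply: span_pairD; exact: span_pair0.
  + by rewrite subrr normr0.
  + by rewrite subrr normr0.
Qed.

End IsometricExtension.

(** * Square integrable functions on the half-line *)

Section SquareIntegrableFunctions.
Variable R : realType.
Local Notation mu := (@lebesgue_measure R).
Local Notation D := (@halfline R).
Local Notation Re := complex.Re.
Local Notation Im := complex.Im.
Implicit Types (f g : R -> R[i]) (u v : R -> R).

(** The squared modulus with values in [R], as integrands require; the norm of [R[i]] takes values
    in [R[i]]. *)
Definition sqmod (z : R[i]) : R := Re z ^+ 2 + Im z ^+ 2.

Lemma sqmod_ge0 z : 0 <= sqmod z.
Proof. by rewrite addr_ge0// sqr_ge0. Qed.

Lemma measurable_halfline : measurable (D : set (measurableTypeR R)).
Proof. exact: measurable_itv. Qed.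
Hint Resolve measurable_halfline : core.

Lemma measurable_sqmod f : measurable_fun D (fun x => Re (f x)) ->
  measurable_fun D (fun x => Im (f x)) -> measurable_fun D (fun x => sqmod (f x)).
Proof.
by move=> mr mi; apply: measurable_funD; exact: measurable_funX.
Qed.

Lemma integrable_dominated u v : measurable_fun D u ->
  (forall x, D x -> `|u x| <= v x) -> mu.-integrable D (EFin \o v) ->
  mu.-integrable D (EFin \o u).
Proof.
move=> mf uv; apply: le_integrable => //; first exact/measurable_EFinP.
by move=> x Dx; rewrite lee_fin (le_trans (uv x Dx))// ler_norm.
Qed.

Lemma square_integrableP f : square_integrable f ->
  [/\ measurable_fun D (fun x => Re (f x)), measurable_fun D (fun x => Im (f x)) &
      mu.-integrable D (EFin \o (fun x => sqmod (f x)))].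
Proof. by []. Qed.

Lemma square_integrable_dominated f v : measurable_fun D (fun x => Re (f x)) ->
  measurable_fun D (fun x => Im (f x)) ->
  (forall x, D x -> sqmod (f x) <= v x) -> mu.-integrable D (EFin \o v) ->
  square_integrable f.
Proof.
move=> mr mi fv iv; split => //.
apply: (@integrable_dominated (fun x => sqmod (f x)) v) => //.
  exact: measurable_sqmod.
by move=> x Dx; rewrite ger0_norm ?sqmod_ge0// fv.
Qed.

Lemma square_integrable_lin a f g : square_integrable f -> square_integrable g ->
  square_integrable (fun x => a * f x + g x).
Proof.
move=> /square_integrableP[mfr mfi qf] /square_integrableP[mgr mgi qg].
apply: (@square_integrable_dominated _
  (fun x => (2 * sqmod a) * sqmod (f x) + 2 * sqmod (g x))).
- rewrite (_ : (fun x => _) = (fun x => Re a * Re (f x) - Im a * Im (f x) + Re (g x))).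
    apply: measurable_funD => //; apply: measurable_funB;
      exact: measurable_funM.
  by apply: boolp.funext => x; case: a => ? ?; case: (f x) => ? ?; case: (g x).
- rewrite (_ : (fun x => _) = (fun x => Re a * Im (f x) + Im a * Re (f x) + Im (g x))).
    apply: measurable_funD => //; apply: measurable_funD;
      exact: measurable_funM.
  by apply: boolp.funext => x; case: a => ? ?; case: (f x) => ? ?; case: (g x).
- move=> x _; rewrite /sqmod.
  case: a => a b; case: (f x) => c d; case: (g x) => p q /=.
  (* Parallelogram law: the bound minus [|a f + g|^2] equals [|a f - g|^2]. *)
  rewrite -subr_ge0 (_ : _ - _ = (a * c - b * d - p) ^+ 2 + (a * d + b * c - q) ^+ 2).
    by rewrite addr_ge0// sqr_ge0.
  by ring.
- have := integrableD measurable_halfline (integrableZl measurable_halfline (2 * sqmod a) qf)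
    (integrableZl measurable_halfline 2 qg).
  exact: eq_integrable.
Qed.

Definition L2_lin (a : R[i]) (f g : L2 R) : L2 R :=
  exist _ (fun x => a * sval f x + sval g x)
    (square_integrable_lin a (svalP f) (svalP g)).

Lemma integrable_mul_conj (f g : L2 R) :
  mu.-integrable D (EFin \o (fun x => Re (sval f x * (sval g x)^*%C))) /\
  mu.-integrable D (EFin \o (fun x => Im (sval f x * (sval g x)^*%C))).
Proof.
case: f g => f sf [g sg] /=.
have /square_integrableP[mfr mfi qf] := sf.
have /square_integrableP[mgr mgi qg] := sg.
have qfg : mu.-integrable D (EFin \o (fun x => sqmod (f x) + sqmod (g x))).
  by have := integrableD measurable_halfline qf qg; apply: eq_integrable.
have bound (a b c d : R) : `|a * c + b * d| <= sqmod (a +i* b) + sqmod (c +i* d).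
  rewrite /sqmod /= ler_norml.
  have := (sqr_ge0 (a + c), sqr_ge0 (b + d), sqr_ge0 (a - c), sqr_ge0 (b - d)).
  have := (sqr_ge0 a, sqr_ge0 b, sqr_ge0 c, sqr_ge0 d).
  move=> [[[? ?] ?] ?] [[[? ?] ?] ?]; apply/andP; split; nra.
split; apply: integrable_dominated qfg.
- rewrite (_ : (fun x => _) = (fun x => Re (f x) * Re (g x) + Im (f x) * Im (g x))).
    by apply: measurable_funD; exact: measurable_funM.
  by apply: boolp.funext => x; case: (f x) => ? ?; case: (g x) => ? ? /=;
    rewrite mulrN opprK.
- move=> x _; move: (bound (Re (f x)) (Im (f x)) (Re (g x)) (Im (g x))).
  by case: (f x) => ? ?; case: (g x) => ? ? /=; rewrite mulrN opprK.
- rewrite (_ : (fun x => _) = (fun x => Im (f x) * Re (g x) - Re (f x) * Im (g x))).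
    by apply: measurable_funB; exact: measurable_funM.
  apply: boolp.funext => x; case: (f x) => ? ?; case: (g x) => ? ? /=.
  by ring.
(* An imaginary part is the real part after multiplication by [-i], so the same bound serves for
   [-i f]. *)
- move=> x _; move: (bound (Im (f x)) (- Re (f x)) (Re (g x)) (Im (g x))).
  rewrite /sqmod; case: (f x) => a b; case: (g x) => c d /=.
  by rewrite sqrrN [b ^+ 2 + _]addrC mulrN mulNr [b * c + _]addrC.
Qed.

Lemma L2_ip_linl a (f g h : L2 R) :
  L2_ip (L2_lin a f g) h = a * L2_ip f h + L2_ip g h.
Proof.
have [rf jf] := integrable_mul_conj f h; have [rg jg] := integrable_mul_conj g h.
have rZ k u : mu.-integrable D (EFin \o u) ->
    mu.-integrable D (EFin \o (fun x => k * u x)).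
  move=> iu; have := integrableZl measurable_halfline k iu.
  exact: eq_integrable.
have rD u v : mu.-integrable D (EFin \o u) -> mu.-integrable D (EFin \o v) ->
    mu.-integrable D (EFin \o (fun x => u x + v x)).
  by move=> iu iv; have := integrableD measurable_halfline iu iv; exact: eq_integrable.
have int3 p q u v w : mu.-integrable D (EFin \o u) ->
    mu.-integrable D (EFin \o v) -> mu.-integrable D (EFin \o w) ->
    \int[mu]_(x in D) (p * u x + q * v x + w x) =
    p * (\int[mu]_(x in D) u x) + q * (\int[mu]_(x in D) v x) +
    \int[mu]_(x in D) w x.
  move=> iu iv iw; have iu' := rZ p _ iu; have iv' := rZ q _ iv.
  have iuv := rD _ _ iu' iv'.
  rewrite (RintegralD measurable_halfline iuv iw).
  rewrite (RintegralD measurable_halfline iu' iv').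
  rewrite (RintegralZl _ measurable_halfline iu).
  by rewrite (RintegralZl _ measurable_halfline iv).
have rE : (\int[mu]_(x in D) Re ((a * sval f x + sval g x) * (sval h x)^*%C)) =
    Re a * Re (L2_ip f h) + (- Im a) * Im (L2_ip f h) + Re (L2_ip g h).
  rewrite -(int3 _ _ _ _ _ rf jf rg).
  apply: eq_Rintegral => x _.
  by case: a (sval f x) (sval g x) (sval h x) => ? ? [? ?] [? ?] [? ?] /=; ring.
have jE : (\int[mu]_(x in D) Im ((a * sval f x + sval g x) * (sval h x)^*%C)) =
    Re a * Im (L2_ip f h) + Im a * Re (L2_ip f h) + Im (L2_ip g h).
  rewrite -(int3 _ _ _ _ _ jf rf jg).
  apply: eq_Rintegral => x _.
  by case: a {rE} (sval f x) (sval g x) (sval h x) => ? ? [? ?] [? ?] [? ?] /=; ring.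
transitivity ((Re a * Re (L2_ip f h) + (- Im a) * Im (L2_ip f h) + Re (L2_ip g h)) +i*
  (Re a * Im (L2_ip f h) + Im a * Re (L2_ip f h) + Im (L2_ip g h))).
  by rewrite -rE -jE.
by case: a {rE jE} (L2_ip f h) (L2_ip g h) => ? ? [? ?] [? ?]; rewrite mulNr.
Qed.

Lemma L2_ip_self (f : L2 R) :
  L2_ip f f = (\int[mu]_(x in D) sqmod (sval f x))%:C.
Proof.
rewrite /L2_ip; congr (_ +i* _).
  apply: eq_Rintegral => x _; rewrite /sqmod; case: (sval f x) => a b /=.
  by ring.
rewrite (_ : (fun x => _) = cst 0) ?Rintegral_cst ?mul0r//.
by apply: boolp.funext => x; case: (sval f x) => a b /=; ring.
Qed.

(** The covariance of Brownian motion: the product of the two indicators is that of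
    [[0, min s t]]. *)
Lemma L2_ip_interval (s t : R) : 0 <= s -> 0 <= t ->
  L2_ip (interval_L2 s) (interval_L2 t) = (Num.min s t)%:C.
Proof.
move=> s0 t0; rewrite /L2_ip /= /interval_fun; congr (_ +i* _); last first.
  rewrite (_ : (fun x => _) = cst 0) ?Rintegral_cst ?mul0r//.
  by apply: boolp.funext => x /=; ring.
have mst : measurable (`[0, Num.min s t] : set R) by exact: measurable_itv.
rewrite (_ : (fun x => _) = \1_(`[0, Num.min s t] : set R)); last first.
  apply: boolp.funext => x /=; rewrite oppr0 mulr0 subr0 !indicE -natrM mulnb -in_setI.
  congr ((x \in _)%:R); apply/seteqP; split => y /=; rewrite !in_itv/= le_min.
    by move=> [/andP[-> ->] /andP[_ ->]].
  by move=> /and3P[-> -> ->].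
rewrite /Rintegral integral_indic//.
rewrite (_ : _ `&` _ = `[0, Num.min s t]%classic); last first.
  apply/seteqP; split => y /=; rewrite !in_itv/=; first by case.
  move=> yst; split => //; rewrite /halfline/= in_itv/= andbT.
  by case/andP: yst.
have := lebesgue_measure_itv `[0, Num.min s t]%R => /= ->; rewrite lte_fin.
have [lt0|] := ltP; first by rewrite -EFinD/= subr0.
(* Degenerate case: a minimum of nonnegative numbers that is at most 0 equals 0. *)
move=> le0; apply/esym/eqP; rewrite eq_le le0/= le_min s0 t0//.
Qed.

End SquareIntegrableFunctions.

(** * Density of the intervals [[0, t]], seen through a multiple of an isometry *)

Section IntervalDensity.
Variables (R : realType) (H : completeNormedModType R[i]).
Variable ip : {dot H for Num.conj}.
Hypothesis normE : hilbert_norm ip.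
Local Notation mu := (@lebesgue_measure R).
Local Notation D := (@halfline R).
Local Notation Re := complex.Re.
Local Notation Im := complex.Im.
Variables (Phi : L2 R -> H) (c : R[i]).
Hypothesis ip_Phi : forall f g, ip (Phi f) (Phi g) = c * L2_ip f g.
Hint Resolve measurable_halfline : core.

(** The difference of the two sides is orthogonal to the range of [Phi], hence to itself. In the
    application [Phi] inserts one letter into an elementary tensor. *)
Lemma Phi_lin a f g : Phi (L2_lin a f g) = a *: Phi f + Phi g.
Proof.
apply/eqP; rewrite -subr_eq0 -(dnorm_eq0 ip); apply/eqP.
set d := Phi _ - _.
have dPhi h : ip d (Phi h) = 0.
  rewrite /d linearBl/= linearDl/= ipZl !ip_Phi L2_ip_linl.
  by rewrite mulrDr mulrCA subrr.
by rewrite {2}/d linearBr/= linearDr/= ipZr !dPhi mulr0 addr0 subrr.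
Qed.

Lemma norm_Phi_sub f g : `|Phi f - Phi g| ^+ 2 =
  c * (\int[mu]_(x in D) sqmod (sval f x - sval g x))%:C.
Proof.
have -> : Phi f - Phi g = Phi (L2_lin (-1) g f).
  by rewrite Phi_lin scaleN1r addrC.
rewrite normE ip_Phi L2_ip_self; congr (_ * _%:C).
by apply: eq_Rintegral => x _ /=; rewrite mulN1r addrC.
Qed.

Variable K : set H.
Hypothesis K_closed : closed_submodule K.

(** The functions that [Phi] sends into [K], taken as plain functions read on the half-line only.
    The class is enlarged step by step, from intervals to all of [L2]. *)
Definition PhiK (q : R -> R[i]) : Prop :=
  exists2 f : L2 R, (forall x, D x -> sval f x = q x) & K (Phi f).

Lemma PhiK_L2 (f : L2 R) : PhiK (sval f) -> K (Phi f).
Proof.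
move=> [g gf Kg]; suff -> : Phi f = Phi g by [].
apply/eqP; rewrite -subr_eq0 -normr_eq0 -sqrf_eq0 norm_Phi_sub.
rewrite (_ : Rintegral _ _ _ = 0) ?mulr0// -[RHS](mul0r (fine (mu D))).
rewrite -Rintegral_cst//; apply: eq_Rintegral => x.
by rewrite inE => Dx; rewrite gf// subrr /sqmod/= expr0n addr0.
Qed.

Lemma PhiK_ext q q' : (forall x, D x -> q x = q' x) -> PhiK q -> PhiK q'.
Proof. by move=> qq' [f fq Kf]; exists f => // x Dx; rewrite fq// qq'. Qed.

Lemma PhiK_lin a q q' : PhiK q -> PhiK q' -> PhiK (fun x => a * q x + q' x).
Proof.
move=> [f fq Kf] [g gq Kg]; exists (L2_lin a f g).
  by move=> x Dx /=; rewrite fq// gq.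
by rewrite Phi_lin; apply: (closed_submoduleP K_closed).
Qed.

(** By dominated convergence the squared distances tend to 0 in [L2]; [Phi] multiplies them by [c],
    so the images converge and the limit stays in the closed set [K]. *)
Lemma PhiK_lim (q_ : nat -> R -> R[i]) q G :
  square_integrable q -> (forall n, PhiK (q_ n)) ->
  mu.-integrable D (EFin \o G) ->
  (forall n x, D x -> sqmod (q x - q_ n x) <= G x) ->
  (forall x, D x -> (fun n => sqmod (q x - q_ n x)) @ \oo --> (0 : R)) ->
  PhiK q.
Proof.
move=> sq Kq iG qG qc; pose f : L2 R := exist _ q sq.
have /choice[f_ f_P] : forall n, exists g : L2 R,
    (forall x, D x -> sval g x = q_ n x) /\ K (Phi g).
  by move=> n; have [g ? ?] := Kq n; exists g.
exists f => //.
apply: (closed_submodule_lim K_closed) => e e0.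
have mq n : measurable_fun D (fun x => sqmod (q x - sval (f_ n) x)).
  have [_ _] := square_integrableP (svalP (L2_lin (-1) (f_ n) f)).
  move=> /measurable_int/measurable_EFinP; apply: eq_measurable_fun => x _ /=.
  by rewrite mulN1r addrC.
have cv : (\int[mu]_(x in D) (sqmod (q x - sval (f_ n) x))%:E)%E @[n --> \oo] -->
    (\int[mu]_(x in D) (0 : R)%:E)%E.
  apply: (@dominated_cvg _ _ _ mu D (@measurable_halfline R)
    (fun n x => (sqmod (q x - sval (f_ n) x))%:E) (fun=> 0%:E) (EFin \o G)) => //.
  - by move=> n; have /measurable_EFinP := mq n.
  - move=> x Dx; apply/cvg_EFin; first by near=> n.
    have := qc x Dx; apply: cvg_trans; apply: near_eq_cvg; near=> n.
    by rewrite /= (f_P n).1.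
  - move=> n x Dx; rewrite /= lee_fin ger0_norm ?sqmod_ge0//.
    by rewrite (f_P n).1// qG.
rewrite integral0 in cv.
have {}cv : (\int[mu]_(x in D) (sqmod (q x - sval (f_ n) x))) @[n --> \oo] --> (0 : R).
  by move: cv => /fine_cvgP[].
(* The added 1 covers [c = 0]. *)
have c0 : 0 < `|c| + 1 by rewrite ltr_wpDl.
have : 0 < e ^+ 2 / (`|c| + 1) by rewrite divr_gt0// exprn_gt0.
rewrite ltcE => /andP[/eqP eI eR].
have [N _ /(_ N (leqnn N)) /=] := (cvgr0_norm_lt _ cv) _ eR.
rewrite -ltcR RRe_real => [lt|]; last by rewrite realE divr_ge0// ?exprn_ge0// ltW.
exists (Phi (f_ N)); first by have [] := f_P N.
rewrite -(@ltr_pXn2r _ 2)// ?nnegrE ?(ltW e0)// norm_Phi_sub.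
set I := Rintegral _ _ _ in lt *.
(* The product is nonnegative because it is a squared norm, whence it equals [|c| |I|]. *)
have I0 : 0 <= c * I%:C.
  by have := exprn_ge0 2 (normr_ge0 (Phi f - Phi (f_ N))); rewrite norm_Phi_sub.
rewrite -(ger0_norm I0) normrM.
rewrite ltr_pdivlMr// in lt; apply: le_lt_trans lt.
have -> : `|I%:C| = `|I|%:C by rewrite normc_def/= expr0n addr0 sqrtr_sqr.
by rewrite mulrC ler_wpM2l ?lerDl// ler0c.
Unshelve. all: by end_near. Qed.

Hypothesis K_interval : forall t, 0 <= t -> K (Phi (interval_L2 t)).

Local Notation J n := (`[0, n%:R]%classic : set R).

Lemma square_integrable_real (u v : R -> R) : measurable_fun D u ->
  (forall x, D x -> u x ^+ 2 <= v x) -> mu.-integrable D (EFin \o v) ->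
  square_integrable (fun x => (u x)%:C).
Proof.
move=> mu' uv; apply: square_integrable_dominated => //=.
by move=> x Dx; rewrite /sqmod/= expr0n addr0 uv.
Qed.

Lemma integrable_J n : mu.-integrable D (EFin \o \1_(J n)).
Proof.
apply: (@integrableS _ _ _ mu setT) => //; exact: integrable_indic_itv.
Qed.

Lemma square_integrable_indic (A : set (measurableTypeR R)) n : measurable A ->
  square_integrable (fun x => (\1_(A `&` J n) x)%:C).
Proof.
move=> mA; apply: (@square_integrable_real _ \1_(J n)); last exact: integrable_J.
  apply: measurable_indic; apply: measurableI => //; exact: measurable_itv.
move=> x _; rewrite !indicE in_setI.
by case: (_ \in A); case: (_ \in J n); rewrite ?expr0n ?expr1n.
Qed.

(** Dynkin's theorem, with the open half-lines []x, +oo[] as generating system. Cutting to [[0, n]]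
    keeps all measures finite. *)
Lemma PhiK_indic (A : set (measurableTypeR R)) n : measurable A ->
  PhiK (fun x => (\1_(A `&` J n) x)%:C).
Proof.
pose P (B : set R) := PhiK (fun x => (\1_(B `&` J n) x)%:C).
have PT : P setT.
  exists (interval_L2 n%:R); last exact: K_interval.
  by move=> x _; rewrite setTI.
rewrite (RGenOInfty.measurableE R).
apply: (@dynkin_induction _ (measurableTypeR R) (@RGenOInfty.G R) P) => //.
- exact: RGenOInfty.measurableE.
- move=> _ _ [x ->] [y ->]; exists (Num.max x y).
  by apply/seteqP; split => z /=; rewrite !in_itv/= !andbT gt_max => /andP.
- move=> _ [x ->]; have [x0|x0] := ltP x 0.
    apply: PhiK_ext PT => y; rewrite /halfline/= in_itv/= andbT => y0.
    congr (_%:C); rewrite !indicE !in_setI !in_setT !mem_setE !in_itv/= andbT.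
    by rewrite (lt_le_trans x0 y0).
  have Px : PhiK (interval_fun (Num.min x n%:R)).
    by exists (interval_L2 (Num.min x n%:R)) => //; apply: K_interval; rewrite le_min x0/=.
  apply: PhiK_ext (PhiK_lin (-1) Px PT) => y _.
  rewrite mulN1r -rmorphN -rmorphD/=; congr (_%:C).
  rewrite !indicE !in_setI !in_setT !mem_setE !in_itv/= andbT.
  rewrite le_min ltNge; case: (0 <= y); case: (y <= x); case: (y <= n%:R) => /=;
    by rewrite ?oppr0 ?addr0 ?addNr ?add0r.
- move=> B mB PB; apply: PhiK_ext (PhiK_lin (-1) PB PT) => y _.
  rewrite mulN1r -rmorphN -rmorphD/=; congr (_%:C).
  rewrite !indicE !in_setI in_setC in_setT.
  by case: (_ \in B); case: (_ \in J n) => /=; rewrite ?oppr0 ?addr0 ?addNr ?add0r.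
- move=> F mF tF PF.
  pose U m : set R := [set x | exists2 i, (i < m)%N & F i x].
  have UF m x : x \in U m -> x \in F m -> False.
    rewrite !inE => -[i im Fix] Fmx; have := tF i m Logic.I Logic.I.
    by move=> /(_ (ex_intro _ x (conj Fix Fmx))) E; rewrite E ltnn in im.
  have PU m : P (U m).
    elim: m => [|m IH].
      have := PhiK_lin (-1) PT PT; apply: PhiK_ext => x _.
      rewrite mulN1r addNr [in RHS](_ : U 0 = set0) ?set0I ?indic0//.
      by apply/seteqP; split => // z [].
    have := PhiK_lin 1 IH (PF m); apply: PhiK_ext => x _.
    rewrite mul1r -rmorphD/=; congr (_%:C).
    have -> : U m.+1 = U m `|` F m.
      apply/seteqP; split => z.
        move=> [k]; rewrite ltnS leq_eqVlt => /orP[/eqP -> | km] Fkz; first by right.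
        by left; exists k.
      by move=> [[k km Fkz]|Fmz]; [exists k => //; rewrite ltnS ltnW|exists m].
    rewrite !indicE !in_setI in_setU; have := @UF m x.
    case: (x \in U m); case: (x \in F m); case: (x \in J n) => /= UFx;
      rewrite ?addr0 ?add0r//; by case: UFx.
  have sqd (B B' : set R) x :
      sqmod ((\1_(B `&` J n) x)%:C - (\1_(B' `&` J n) x)%:C) <= (\1_(J n) x : R).
    rewrite /sqmod -rmorphB/= expr0n addr0 !indicE !in_setI.
    by case: (x \in B); case: (x \in B'); case: (x \in J n) => /=;
      rewrite ?subr0 ?sub0r ?subrr ?sqrrN ?expr1n ?expr0n.
  apply: (@PhiK_lim (fun m x => (\1_(U m `&` J n) x)%:C) _ \1_(J n)) => //.
  + by apply: square_integrable_indic; exact: bigcupT_measurable.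
  + exact: integrable_J.
  + move=> x _; apply: cvg_near_cst.
    have [[i _ Fix]|nFx] := pselect ((\bigcup_k F k) x).
      exists i.+1 => // m /= im; rewrite !indicE !in_setI.
      rewrite (mem_set (A := \bigcup_k F k)); last by exists i.
      by rewrite (mem_set (A := U m)) ?subrr ?/sqmod/= ?expr0n ?addr0//; exists i.
    near=> m; rewrite !indicE !in_setI.
    rewrite (memNset (A := \bigcup_k F k))// (memNset (A := U m)).
      by rewrite subrr /sqmod/= expr0n addr0.
    by move=> [i _ Fix]; apply: nFx; exists i.
Unshelve. all: by end_near. Qed.

Import HBNNSimple.

Lemma PhiK_nnsfun (g : {nnsfun (measurableTypeR R) >-> R}) n :
  PhiK (fun x => (g x * \1_(J n) x)%:C).
Proof.
have sumK (s : seq R) :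
    PhiK (fun x => (\sum_(y <- s) y * \1_(g @^-1` [set y] `&` J n) x)%:C).
  elim: s => [|y s IH].
    have P0 := @PhiK_indic set0 n measurable0.
    have := PhiK_lin (-1) P0 P0; apply: PhiK_ext => x _.
    by rewrite big_nil mulN1r addNr.
  have mg : measurable (g @^-1` [set y]) by exact: measurable_funPTI.
  have := PhiK_lin y%:C (@PhiK_indic _ n mg) IH; apply: PhiK_ext => x _.
  by rewrite big_cons -rmorphM -rmorphD.
apply: PhiK_ext (sumK (finmap.enum_fset (fset_set (range g)))) => x _.
congr (_%:C); rewrite (fimfunE g) fsbig_finite//= mulr_suml; apply: eq_bigr => y _.
by rewrite indicI mulrA.
Qed.

(** Simple functions increasing to [u], cut to [[0, n]], converge pointwise, and the squared errors
    are dominated by [u ^+ 2]. *)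
Lemma PhiK_nonneg (u : R -> R) : (forall x, D x -> 0 <= u x) ->
  measurable_fun D u -> mu.-integrable D (EFin \o (fun x => u x ^+ 2)) ->
  PhiK (fun x => (u x)%:C).
Proof.
move=> u0 mu0 iu2.
have mEu : measurable_fun (D : set (measurableTypeR R)) (EFin \o u).
  exact/measurable_EFinP.
have Eu0 x : D x -> (0 <= (EFin \o u) x)%E by move=> Dx; rewrite lee_fin u0.
pose g := nnsfun_approx (@measurable_halfline R) mEu.
have g0 n x : 0 <= g n x by [].
have gu n x : D x -> g n x <= u x.
  by move=> Dx; rewrite -lee_fin /g nnsfun_approxE; exact: (le_approx n Eu0 Dx).
have sqE (a b : R) : sqmod (a%:C - b%:C) = (a - b) ^+ 2.
  by rewrite /sqmod -rmorphB/= expr0n addr0.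
apply: (@PhiK_lim (fun n x => (g n x * \1_(J n) x)%:C) _ (fun x => u x ^+ 2)) => //.
- by apply: (@square_integrable_real _ (fun x => u x ^+ 2)).
- by move=> n; exact: PhiK_nnsfun.
- move=> n x Dx; rewrite sqE.
  have : 0 <= u x - g n x * \1_(J n) x <= u x.
    rewrite indicE; case: (_ \in _); rewrite ?mulr1 ?mulr0 ?subr0 ?lexx ?u0//.
    by rewrite subr_ge0 gu//= lerBlDr lerDl.
  by move=> /andP[? ?]; rewrite lerXn2r ?nnegrE ?u0.
- move=> x Dx; under eq_fun do rewrite sqE.
  have cg : (fun n => g n x) @ \oo --> u x.
    have /fine_cvgP[_] := cvg_nnsfun_approx (@measurable_halfline R) mEu Eu0 Dx.
    by [].
  have c0 : (fun n => (u x - g n x) ^+ 2) @ \oo --> (0 : R).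
    have c1 : (fun n => u x - g n x) @ \oo --> (0 : R).
      by rewrite -[X in _ --> X](subrr (u x)); apply: cvgB => //; exact: cvg_cst.
    by rewrite -[X in _ --> X](mulr0 (0 : R)); exact: cvgM.
  (* Once [n >= x], the cut to [[0, n]] does not change the value at [x]. *)
  apply: cvg_trans c0; apply: near_eq_cvg; near=> n.
  rewrite indicE mem_set ?mulr1//= in_itv/=; apply/andP; split.
    by move: Dx; rewrite /halfline/= in_itv/= andbT.
  near: n; exact: nbhs_infty_ger.
Unshelve. all: by end_near. Qed.

(** [u] is the difference of the nonnegative functions [|u| + u] and [|u|]. *)
Lemma PhiK_real (u : R -> R) : measurable_fun D u ->
  mu.-integrable D (EFin \o (fun x => u x ^+ 2)) -> PhiK (fun x => (u x)%:C).
Proof.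
move=> mu0 iu2.
have mn : measurable_fun D (fun x => `|u x|) by exact: measurableT_comp.
have P1 : PhiK (fun x => `|u x|%:C).
  apply: PhiK_nonneg => //; apply: eq_integrable iu2 => // x _ /=.
  by rewrite real_normK// num_real.
have P2 : PhiK (fun x => (`|u x| + u x)%:C).
  apply: PhiK_nonneg => //; first by move=> x _; rewrite -lerBlDr sub0r ler_normr lexx orbT.
    exact: measurable_funD.
  apply: (@integrable_dominated _ _ (fun x => 4 * u x ^+ 2)).
  - by apply: measurable_funX; exact: measurable_funD.
  - move=> x _; rewrite ger0_norm ?sqr_ge0//.
    rewrite (_ : 4 * _ = (2 * `|u x|) ^+ 2); last first.
      by rewrite exprMn real_normK ?num_real// -natrX.
    rewrite lerXn2r ?nnegrE ?mulr_ge0//.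
      by rewrite -lerBlDr sub0r ler_normr lexx orbT.
    by rewrite mulr2n mulrDl mul1r lerD2l ler_norm.
  - by have := integrableZl (@measurable_halfline R) 4 iu2; exact: eq_integrable.
apply: PhiK_ext (PhiK_lin (-1) P1 P2) => x _.
by rewrite mulN1r rmorphD/= addKr.
Qed.

Lemma L2_interval_dense (f : L2 R) : K (Phi f).
Proof.
apply: PhiK_L2; have [mr mi q] := square_integrableP (svalP f).
have iP (u : R -> R) : measurable_fun D u ->
    (forall x, u x ^+ 2 <= sqmod (sval f x)) ->
    PhiK (fun x => (u x)%:C).
  move=> mu0 uf; apply: PhiK_real => //.
  apply: (@integrable_dominated _ _ (fun x => sqmod (sval f x))) => //.
    exact: measurable_funX.
  by move=> x _; rewrite ger0_norm ?sqr_ge0.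
have Pr : PhiK (fun x => (Re (sval f x))%:C).
  by apply: iP => // x; rewrite /sqmod lerDl sqr_ge0.
have Pi : PhiK (fun x => (Im (sval f x))%:C).
  by apply: iP => // x; rewrite /sqmod lerDr sqr_ge0.
by apply: PhiK_ext (PhiK_lin 'i%C Pi Pr) => x _; rewrite addrC -complexE.
Qed.

End IntervalDensity.

(** * Generated von Neumann algebras and commutants *)

Section VonNeumannAlgebras.
Variables (R : realType) (H : completeNormedModType R[i]).
Variable ip : {dot H for Num.conj}.
Hypothesis normE : hilbert_norm ip.
Implicit Types (A B T : H -> H) (X : set (H -> H)).

(** One member of the intersection defining the generated algebra; it shows that the elements of the
    latter are bounded. *)
Lemma vna_bounded_operators : von_neumann_algebra ip (@bounded_operator R H).
Proof.
split => //.
- exact: bounded_id.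
- by move=> A B; exact: bounded_add.
- by move=> c A; exact: bounded_scale.
- by move=> A B; exact: bounded_comp.
Qed.

Lemma vna_generated X : (forall A, X A -> bounded_operator A) ->
  von_neumann_algebra ip (generated_vna ip X).
Proof.
move=> bX; split.
- by move=> A /(_ _ (conj vna_bounded_operators bX)).
- by move=> M [vM _]; exact: vna_id vM.
- by move=> A B gA gB M MX; apply: (vna_add MX.1); [exact: gA|exact: gB].
- by move=> c A gA M MX; apply: (vna_scale MX.1); exact: gA.
- by move=> A B gA gB M MX; apply: (vna_comp MX.1); [exact: gA|exact: gB].
- by move=> A B bB AB gA M MX; apply: (vna_adjoint MX.1 bB AB); exact: gA.
- move=> A bA wA M MX; apply: (vna_closed MX.1) => // n x y e e0.
  by have [B gB Be] := wA n x y e e0; exists B => //; exact: gB.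
Qed.

Lemma sub_generated X : X `<=` generated_vna ip X.
Proof. by move=> A XA M [_]; exact. Qed.

(** Makes it enough to check commutation on generators: an algebra generated by operators commuting
    with [X] lies in this commutant. *)
Lemma vna_commutant X :
  (forall T, X T -> bounded_operator T /\ adjoint ip T T) ->
  von_neumann_algebra ip
    [set A | bounded_operator A /\ forall T, X T -> forall x, A (T x) = T (A x)].
Proof.
move=> XP; split => /=.
- by move=> A [].
- by split => //; exact: bounded_id.
- move=> A B [bA cA] [bB cB]; split; first exact: bounded_add.
  by move=> T XT x; rewrite cA// cB// (linD (XP T XT).1.1).
- move=> c A [bA cA]; split; first exact: bounded_scale.
  by move=> T XT x; rewrite cA// (linZ (XP T XT).1.1).
- move=> A B [bA cA] [bB cB]; split; first exact: bounded_comp.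
  by move=> T XT x /=; rewrite cB// cA.
- move=> A B bB AB [bA cA]; split => // T XT x.
  apply/eqP; rewrite -subr_eq0 -(dnorm_eq0 ip); apply/eqP.
  set d := _ - _; have [_ TT] := XP T XT.
  by rewrite {2}/d linearBr/= -AB -TT -TT -AB cA// subrr.
- move=> A bA wA; split => // T XT x.
  have [bT TT] := XP T XT.
  apply/eqP; rewrite -subr_eq0 -(dnorm_eq0 ip); apply/eqP.
  set d := _ - _.
  apply: (@small_eq0 _ _ 2) => e e0.
  have eE : (complex.Re e)%:C = e by rewrite RRe_real// realE ltW.
  have e0' : 0 < complex.Re e by rewrite -ltcR eE.
  (* Two matrix coefficients suffice: with [d = A (T x) - T (A x)], [ip d d] is the coefficient of
     [A] at [(T x, d)] minus that at [(x, T d)], and for [B] these two agree. *)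
  have [B [bB cB] Be] := wA 2 (fun i => if i == ord0 then T x else x)
    (fun i => if i == ord0 then d else T d) _ e0'.
  have := Be (lift ord0 ord0); have := Be ord0; rewrite !eqxx eE/= => B1 B2.
  rewrite {1}/d linearBl/= TT.
  have -> : ip (A (T x)) d - ip (A x) (T d) =
      (ip (A (T x)) d - ip (B (T x)) d) - (ip (A x) (T d) - ip (B x) (T d)).
    by rewrite cB// TT opprB addrA addrNK.
  rewrite (le_trans (ler_normB _ _))// mulr2n mulrDl mul1r lerD// ltW//.
Qed.

End VonNeumannAlgebras.

(** * Elementary tensors and the flip *)

Section FullFockSpace.
Variables (R : realType) (H : completeNormedModType R[i]).
Variable ip : {dot H for Num.conj}.
Variable tens : seq (L2 R) -> H.
Hypothesis fockH : full_fock_space ip tens.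
Let normE : hilbert_norm ip := fock_hilbert fockH.
Let vac := tens [::].

(** Density of the span of elementary tensors, as an induction principle. *)
Lemma tens_ind (K : set H) : closed_submodule K ->
  (forall g, K (tens g)) -> forall x, K x.
Proof.
move=> cK Kt x; apply: (closed_submodule_lim cK) => e e0.
have : [set: H] x by [].
rewrite -(fock_dense fockH) => /(_ _ (nbhsx_ballx x e e0)) [v [[n [c [g ->]]]]].
rewrite -ball_normE /= => xv; eexists; last exact: xv.
elim/big_ind: _ => [|y z|k _]; first exact: closed_submodule0.
- exact: closed_submoduleD.
- by apply: closed_submoduleZ.
Qed.

Lemma eq_bounded (A B : H -> H) : bounded_operator A -> bounded_operator B ->
  (forall g, A (tens g) = B (tens g)) -> forall x, A x = B x.
Proof.
move=> bA bB AB x; apply/eqP; rewrite -subr_eq0; apply/eqP; move: x.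
apply: (tens_ind (bounded_ker_closed (bounded_sub bA bB))) => g /=.
by rewrite AB subrr.
Qed.

Lemma eq_ip_tens x y : (forall g, ip x (tens g) = ip y (tens g)) -> x = y.
Proof.
move=> xy; apply/eqP; rewrite -subr_eq0 -(dnorm_eq0 ip); apply/eqP.
have cK : closed_submodule [set z : H | ip z (x - y) = 0].
  apply: (@lipschitz_ker_closed _ _ _ _ `|x - y|).
  - by rewrite linear0l.
  - by move=> a u v; rewrite linearDl/= ipZl => -> ->; rewrite mulr0 addr0.
  - by move=> u v; rewrite -linearBl mulrC cauchy_schwarz.
apply: (tens_ind cK) => g /=.
by rewrite linearBr/= ![ip (tens g) _]ipC xy subrr.
Qed.

Lemma vac_unit : ip vac vac = 1.
Proof. by rewrite /vac (fock_ip fockH)/= big_nil. Qed.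

Lemma ip_cons_vac k g : ip (tens (k :: g)) vac = 0.
Proof. by rewrite /vac (fock_ip fockH). Qed.

Lemma ip_cons k g s f : ip (tens (k :: g)) (tens (s :: f)) =
  L2_ip k s * ip (tens g) (tens f).
Proof.
rewrite !(fock_ip fockH)/= eqSS; case: eqP => _; last by rewrite mulr0.
by rewrite big_cons.
Qed.

Lemma ip_rev g f : ip (tens (rev g)) (tens (rev f)) = ip (tens g) (tens f).
Proof.
rewrite !(fock_ip fockH) !size_rev; case: eqP => // gf.
by rewrite -rev_zip ?big_rev// gf.
Qed.

Lemma ip_insert (a b : seq (L2 R)) f g :
  ip (tens (a ++ f :: b)) (tens (a ++ g :: b)) =
  ip (tens a) (tens a) * ip (tens b) (tens b) * L2_ip f g.
Proof.
rewrite !(fock_ip fockH) !size_cat/= !eqxx zip_cat// big_cat big_cons /=.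
by rewrite -mulrA [in RHS](mulrC _ (L2_ip f g)).
Qed.

Lemma flip_ex : exists U : H -> H, [/\ linear U, forall x, `|U x| = `|x| &
  forall g, U (tens g) = tens (rev g)].
Proof.
apply: (isometric_extension normE); last exact: (fock_dense fockH).
by move=> g f; exact: ip_rev.
Qed.

End FullFockSpace.

(** * Left and right field operators *)

Section FieldOperators.
Variables (R : realType) (H : completeNormedModType R[i]).
Variable ip : {dot H for Num.conj}.
Variable tens : seq (L2 R) -> H.
Hypothesis fockH : full_fock_space ip tens.
Let normE : hilbert_norm ip := fock_hilbert fockH.
Let vac := tens [::].

Variables l l' : R -> H -> H.
Hypothesis lP : forall t, 0 <= t -> left_creation tens (interval_L2 t) (l t).
Hypothesis l'_bounded : forall t, 0 <= t -> bounded_operator (l' t).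
Hypothesis l_adjoint : forall t, 0 <= t -> adjoint ip (l t) (l' t).

Variable U : H -> H.
Hypothesis U_linear : linear U.
Hypothesis U_norm : forall x, `|U x| = `|x|.
Hypothesis U_tens : forall g, U (tens g) = tens (rev g).

Local Notation S t x := (l t x + l' t x).
Local Notation Sr t x := (U (l t (U x) + l' t (U x))).
Local Notation min s t := ((Num.min s t)%:C : R[i]).

Lemma U_bounded : bounded_operator U.
Proof. by split => //; exists 1 => x; rewrite mul1r U_norm. Qed.

Lemma U_involutive x : U (U x) = x.
Proof.
move: x; apply: (eq_bounded fockH); first exact: bounded_comp U_bounded U_bounded.
  exact: bounded_id.
by move=> g; rewrite !U_tens revK.
Qed.

(** An isometric involution is its own adjoint. *)
Lemma U_selfadjoint : adjoint ip U U.
Proof.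
by move=> x y; rewrite -{1}(U_involutive y) (isometry_ip normE U_linear U_norm).
Qed.

Local Notation I := (@interval_L2 R).
Local Notation r t x := (U (l t (U x))).
Local Notation r' t x := (U (l' t (U x))).

Lemma U_vac : U vac = vac.
Proof. exact: U_tens. Qed.

Lemma l_bounded t : 0 <= t -> bounded_operator (l t).
Proof. by move=> /lP[]. Qed.

Lemma l_tens t g : 0 <= t -> l t (tens g) = tens (I t :: g).
Proof. by move=> /lP[]. Qed.

Lemma l'_adjoint t : 0 <= t -> adjoint ip (l' t) (l t).
Proof. by move=> t0 x y; rewrite (ipC ip) -l_adjoint// -(ipC ip). Qed.

Lemma l'_vac t : 0 <= t -> l' t vac = 0.
Proof.
move=> t0; apply: (eq_ip_tens fockH) => f.
by rewrite l'_adjoint// l_tens// linear0l (ipC ip) ip_cons_vac// conjC0.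
Qed.

Lemma l'_cons t k g : 0 <= t -> l' t (tens (k :: g)) = L2_ip k (I t) *: tens g.
Proof.
move=> t0; apply: (eq_ip_tens fockH) => f.
by rewrite l'_adjoint// l_tens// (ip_cons fockH) ipZl.
Qed.

Lemma r_tens t g : 0 <= t -> r t (tens g) = tens (rcons g (I t)).
Proof. by move=> t0; rewrite U_tens l_tens// U_tens rev_cons revK. Qed.

Lemma r_bounded t : 0 <= t -> bounded_operator (fun x => r t x).
Proof.
move=> /l_bounded bl.
exact: bounded_comp U_bounded (bounded_comp bl U_bounded).
Qed.

Lemma r'_adjoint t x y : 0 <= t -> ip (r' t x) y = ip x (r t y).
Proof. by move=> t0; rewrite U_selfadjoint l'_adjoint// U_selfadjoint. Qed.

Lemma l'_l s t x : 0 <= s -> 0 <= t -> l' s (l t x) = min t s *: x.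
Proof.
move=> s0 t0; move: x; apply: (eq_bounded fockH).
- exact: bounded_comp (l'_bounded s0) (l_bounded t0).
- exact: bounded_scale _ (@bounded_id _ _).
- by move=> g; rewrite l_tens// l'_cons// L2_ip_interval.
Qed.

(** The two operators act at opposite ends of a word and interfere only on the vacuum, where the
    letter just created on the right is the one removed on the left. *)
Lemma l'_r s t x : 0 <= s -> 0 <= t ->
  l' s (r t x) = r t (l' s x) + min t s *: (ip x vac *: vac).
Proof.
move=> s0 t0; have bl' := l'_bounded s0; have br := r_bounded t0.
move: x; apply: (eq_bounded fockH).
- exact: (bounded_comp bl' br).
- apply: bounded_add; first exact: (bounded_comp br bl').
  exact: bounded_scale _ (bounded_rank1 normE vac).
move=> [|k g]; rewrite r_tens//=.
  rewrite l'_vac// !(lin0 U_linear, lin0 (l_bounded t0).1) add0r.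
  by rewrite l'_cons// L2_ip_interval// (vac_unit fockH) scale1r.
rewrite !l'_cons// (ip_cons_vac fockH) scale0r scaler0 addr0.
by rewrite !(linZ U_linear, linZ (l_bounded t0).1) r_tens.
Qed.

Lemma l_r s t x : 0 <= s -> 0 <= t -> l s (r t x) = r t (l s x).
Proof.
move=> s0 t0; have bl := l_bounded s0; have br := r_bounded t0.
move: x; apply: (eq_bounded fockH).
- exact: (bounded_comp bl br).
- exact: (bounded_comp br bl).
by move=> g; rewrite r_tens// !l_tens// [RHS]r_tens.
Qed.

Lemma l'_r' s t x : 0 <= s -> 0 <= t -> l' s (r' t x) = r' t (l' s x).
Proof.
move=> s0 t0; apply: (eq_ip_tens fockH) => g.
by rewrite r'_adjoint// !l'_adjoint// l_r// r'_adjoint.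
Qed.

(** The mirror image of [l'_r] under the flip. *)
Lemma r'_l s t x : 0 <= s -> 0 <= t ->
  r' t (l s x) = l s (r' t x) + min s t *: (ip x vac *: vac).
Proof.
move=> s0 t0; have := congr1 U (l'_r (U x) t0 s0).
rewrite !U_involutive (linD U_linear) !(linZ U_linear) U_vac U_involutive.
by rewrite U_selfadjoint U_vac.
Qed.

(** Creations commute with each other, and so do annihilations. The two mixed commutators are
    opposite multiples of the vacuum projection and cancel. *)
Lemma field_commute s t x : 0 <= s -> 0 <= t ->
  S s (Sr t x) = Sr t (S s x).
Proof.
move=> s0 t0.
have lD u y z : 0 <= u -> l u (y + z) = l u y + l u z.
  by move=> /l_bounded[/linD ->].
have l'D u y z : 0 <= u -> l' u (y + z) = l' u y + l' u z.
  by move=> /l'_bounded[/linD ->].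
have SrD y z : Sr t (y + z) = Sr t y + Sr t z.
  by rewrite !(linD U_linear) lD// l'D// !(linD U_linear) addrACA.
rewrite SrD !(linD U_linear) lD// l'D// l_r// l'_r// l'_r'// r'_l//.
rewrite minC !addrA; congr (_ + _).
rewrite -!addrA; congr (_ + _).
by congr (_ + _); exact: addrC.
Qed.

Lemma field_selfadjoint t : 0 <= t -> adjoint ip (fun x => Sr t x) (fun x => Sr t x).
Proof.
move=> t0 x y /=; rewrite U_selfadjoint linearDl/= l_adjoint// l'_adjoint//.
by rewrite addrC -linearDr; exact: U_selfadjoint.
Qed.

(** * Increments over []n, n + 1]] *)

Section Increment.
Variable n : nat.
Let L x := l n.+1%:R x - l n%:R x.
Let L' x := l' n.+1%:R x - l' n%:R x.
Let n0 : 0 <= n%:R :> R. Proof. by []. Qed.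
Let n1 : 0 <= n.+1%:R :> R. Proof. by []. Qed.

Let L_adjoint : adjoint ip L L'.
Proof. by move=> x y; rewrite /L /L' linearBl linearBr/= !l_adjoint. Qed.

(** The squared norm of the indicator of []n, n + 1]], expanded bilinearly. *)
Let Ln : min n.+1%:R n.+1%:R - min n.+1%:R n%:R - (min n.+1%:R n%:R - min n%:R n%:R) = 1.
Proof.
rewrite !minxx min_r ?ler_nat// subrr subr0.
by rewrite -rmorphB -natrB// subSnn.
Qed.

Lemma increment_bounded : bounded_operator L'.
Proof. by apply: bounded_sub; apply: l'_bounded. Qed.

Lemma increment_isometry x : L' (L x) = x.
Proof.
rewrite /L' /L !(linB (l'_bounded _).1)// !l'_l// -!scalerBl.
rewrite -[RHS]scale1r -Ln; congr (_ *: _).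
by rewrite [Num.min n%:R n.+1%:R]minC.
Qed.

Lemma increment_norm x : `|L' x| <= `|x|.
Proof. exact: (contraction_adjoint normE L_adjoint increment_isometry). Qed.

Let norm_L x : `|L x| = `|x|.
Proof.
by apply/eqP; rewrite -(@eqrXn2 _ 2)// !normE L_adjoint increment_isometry.
Qed.

Let increment_r x : L' (U (L (U x))) = U (L (U (L' x))) + ip x vac *: vac.
Proof.
rewrite /L' /L !(linB U_linear) !(linB (l'_bounded _).1)// !l'_r//.
rewrite !(linB (l_bounded _).1)// !(linB U_linear).
have subDD (A a B b : H) : (A + a) - (B + b) = (A - B) + (a - b).
  by rewrite opprD addrACA.
(* The four instances of [l'_r] are collected; by [Ln] their vacuum terms add up to [P] with
   coefficient 1. *)
have E4 (A B C D P : H) (a b d : R[i]) : a - b - (b - d) = 1 ->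
    A + a *: P - (B + b *: P) - (C + b *: P - (D + d *: P)) = A - C - (B - D) + P.
  move=> abd; rewrite (subDD A _ B) (subDD C _ D) (subDD (A - B)) -!scalerBl abd.
  rewrite scale1r; congr (_ + _).
  by rewrite !opprB addrACA [RHS]addrACA [- B + _]addrC.
by rewrite [Num.min n%:R n.+1%:R]minC; apply: E4; exact: Ln.
Qed.

(** The component of [xi] orthogonal to the vacuum is bounded by norms that vanish as [n] grows: [L]
    and [U] are isometric and [L'] is a contraction. *)
Lemma increment_bound xi :
  (forall t, 0 <= t -> S t xi = Sr t xi) ->
  `|xi - ip xi vac *: vac| <= `|L' xi| + `|L' (U xi)| + `|L' xi|.
Proof.
move=> Sxi.
have eq1 : L xi + L' xi = U (L (U xi)) + U (L' (U xi)).
  rewrite /L /L' !(linB U_linear) [RHS]addrACA -opprD -!(linD U_linear).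
  by rewrite -(Sxi _ n1) -(Sxi _ n0) opprD addrACA.
have L'D y z : L' (y + z) = L' y + L' z := linD increment_bounded.1 y z.
have E : xi + L' (L' xi) =
    U (L (U (L' xi))) + ip xi vac *: vac + L' (U (L' (U xi))).
  rewrite -[X in X + _]increment_isometry -(L'D (L xi) (L' xi)) eq1.
  by rewrite (L'D (U (L (U xi)))) increment_r.
have -> : xi - ip xi vac *: vac =
    U (L (U (L' xi))) + L' (U (L' (U xi))) - L' (L' xi).
  have move_terms (a b c d e : H) : a + b = c + d + e -> a - d = c + e - b.
    by move=> /(canRL (addrK _)) ->; rewrite (addrAC c) [_ - b - d]addrAC addrK.
  exact: move_terms E.
rewrite (le_trans (ler_normB _ _))// lerD ?increment_norm//.
rewrite (le_trans (ler_normD _ _))// lerD//.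
  by rewrite U_norm norm_L U_norm.
by rewrite (le_trans (increment_norm _))// U_norm.
Qed.

End Increment.

Let increment_orthonormal i j :
  ip (tens [:: I i.+1%:R] - tens [:: I i%:R])
     (tens [:: I j.+1%:R] - tens [:: I j%:R]) = (i == j)%:R.
Proof.
have ipI (m n : nat) :
    ip (tens [:: I m%:R]) (tens [:: I n%:R]) = (minn m n)%:R.
  rewrite (ip_cons fockH) (vac_unit fockH) mulr1 L2_ip_interval//.
  rewrite -[RHS](rmorph_nat (real_complex R)); congr (_%:C).
  by case: (leqP m n) => mn; [rewrite min_l|rewrite min_r]; rewrite ?ler_nat// ltnW.
(* The orthonormality relation, arranged without subtraction so as to hold in [nat]. *)
have min_eq : (minn i.+1 j.+1 + minn i j = (i == j) + (minn i.+1 j + minn i j.+1))%N.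
  by case: eqP => /= [->|]; lia.
have := congr1 (fun n => n%:R : R[i]) min_eq; rewrite !natrD => E.
by rewrite linearBl/= !linearBr/= !ipI opprB addrACA -opprD E addrK.
Qed.

(** On an elementary tensor the operator removes the first letter and multiplies by its inner
    product with the [n]-th unit vector, which tends to 0 by Bessel. Uniform contractivity extends
    this to all vectors. *)
Lemma increment_vanish x e : 0 < e -> exists N, forall n, (N <= n)%N ->
  `|l' n.+1%:R x - l' n%:R x| < e.
Proof.
move: x e; pose K := [set x : H | forall e, 0 < e -> exists N, forall n, (N <= n)%N ->
  `|l' n.+1%:R x - l' n%:R x| < e].
suff cK : closed_submodule K.
  apply: (tens_ind fockH cK) => -[|k g] e e0.
    by exists 0%N => n _; rewrite !l'_vac// subrr normr0.
  have e1 : 0 < e / (`|tens g| + 1) by rewrite divr_gt0// ltr_wpDl.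
  (* Inner products of letters are read in [H] as those of one-letter tensors. *)
  have [N NP] := orthonormal_weak0 increment_orthonormal (tens [:: k]) e1.
  exists N => n /NP; rewrite !l'_cons// -scalerBl normrZ.
  rewrite linearBr/= !(ip_cons fockH) (vac_unit fockH) !mulr1.
  rewrite ltr_pdivlMr ?ltr_wpDl//; apply: le_lt_trans.
  by rewrite ler_wpM2l// lerDl.
have bL n := (increment_bounded n).1.
split.
- by move=> e e0; exists 0%N => n _; rewrite (lin0 (bL n)) normr0.
- move=> a x y Kx Ky e e0.
  have e2 : 0 < e / 2 by rewrite divr_gt0.
  have e3 : 0 < e / 2 / (`|a| + 1) by rewrite divr_gt0// ltr_wpDl.
  have [N NP] := Kx _ e3; have [M MP] := Ky _ e2.
  exists (maxn N M) => n; rewrite geq_max => /andP[/NP xn /MP yn].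
  rewrite (bL n) (le_lt_trans (ler_normD _ _))// [ltRHS]splitr ler_ltD//.
  rewrite normrZ; rewrite ltr_pdivlMr ?ltr_wpDl// in xn.
  by rewrite (le_trans _ (ltW xn))// mulrC ler_wpM2l// lerDl.
- move=> x xK e e0.
  have e2 : 0 < e / 2 by rewrite divr_gt0.
  have [v Kv xv] := xK _ e2; have [N NP] := Kv _ e2.
  exists N => n /NP vn; rewrite -[x](subrK v).
  rewrite (linD (bL n)) (le_lt_trans (ler_normD _ _))// [ltRHS]splitr ltrD//.
  exact: le_lt_trans (increment_norm _ _) xv.
Qed.

Lemma field_commuting_vector xi :
  (forall t, 0 <= t -> S t xi = Sr t xi) -> xi = ip xi vac *: vac.
Proof.
move=> Sxi; apply/eqP; rewrite -subr_eq0; apply/eqP.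
apply: (@small_eq0 _ _ (1 + 1 + 1)) => e e0.
have [N NP] := increment_vanish xi e0; have [M MP] := increment_vanish (U xi) e0.
apply: le_trans (increment_bound (maxn N M) Sxi) _.
have xe := ltW (NP _ (leq_maxl N M)); have ye := ltW (MP _ (leq_maxr N M)).
by rewrite !mulrDl !mul1r !lerD.
Qed.

(** [W] kills whatever the field operators produce from the vacuum. Since creation is the field
    operator minus annihilation, this reaches all words in interval letters, then all tensors by
    density. *)
Lemma vacuum_separating (W : H -> H) : bounded_operator W ->
  (forall t, 0 <= t -> forall x, W (S t x) = S t (W x)) -> W vac = 0 ->
  forall x, W x = 0.
Proof.
move=> bW WS W0; have cK := bounded_ker_closed bW.
have bS t : 0 <= t -> bounded_operator (fun x => S t x).
  by move=> t0; apply: bounded_add; [exact: l_bounded|exact: l'_bounded].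
have step t g : 0 <= t -> W (tens g) = 0 -> W (l' t (tens g)) = 0 ->
    W (tens (I t :: g)) = 0.
  move=> t0 Wg Wl'; rewrite -l_tens// -[l t _](addrK (l' t (tens g))).
  by rewrite (linB bW.1) WS// Wg Wl' (lin0 (bS _ t0).1) subrr.
have word ts : (forall t, t \in ts -> 0 <= t) -> W (tens (map I ts)) = 0.
  move=> ts0.
  (* Annihilation shortens a word, so the induction carries two consecutive lengths. *)
  suff: W (tens (map I ts)) = 0 /\
      forall t, 0 <= t -> W (tens (I t :: map I ts)) = 0 by case.
  elim: ts ts0 => [|s ts IH] ts0.
    split => // t t0; apply: step => //.
    by rewrite l'_vac// (lin0 bW.1).
  have s0 : 0 <= s by apply: ts0; rewrite mem_head.
  have [Wts Wsts] : W (tens (map I ts)) = 0 /\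
      forall t, 0 <= t -> W (tens (I t :: map I ts)) = 0.
    by apply: IH => t tts; apply: ts0; rewrite inE tts orbT.
  split; first exact: Wsts.
  move=> t t0; apply: step => //; first exact: Wsts.
  by rewrite l'_cons// (linZ bW.1) Wts scaler0.
apply: (tens_ind fockH cK) => g /=.
suff: forall ts, (forall t, t \in ts -> 0 <= t) -> W (tens (g ++ map I ts)) = 0.
  by move=> /(_ [::])/=; rewrite cats0; apply => t; rewrite in_nil.
(* The letters of [g] are replaced from the right, one at a time: with all the
   others fixed, [tens] is a multiple of an isometry of the remaining one. *)
elim/last_ind: g => [|g k IH] ts ts0; first exact: word.
rewrite cat_rcons.
have Phi := ip_insert fockH g (map I ts).
apply: (L2_interval_dense normE Phi cK) => t t0 /=.
apply: (IH (t :: ts)) => s; rewrite inE => /predU1P[->//|]; exact: ts0.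
Qed.

End FieldOperators.

(** * The center of the generated algebra *)

Unset Implicit Arguments.

Theorem corollary1 (R : realType) (H : completeNormedModType R[i])
    (ip : {dot H for Num.conj}) (tens : seq (L2 R) -> H)
    (fockH : full_fock_space ip tens)
    (S : R -> H -> H) (S_fbm : free_brownian_motion ip tens S) :
  is_factor ip (generated_vna ip [set A | exists2 t : R, 0 <= t & A = S t]).
Proof.
have normE := fock_hilbert fockH.
have /choice[l /choice[l' lP]] : forall t, exists l l', 0 <= t ->
    [/\ left_creation tens (interval_L2 t) l, bounded_operator l',
        adjoint ip l l' & S t = (fun x => l x + l' x)].
  (* For negative [t] nothing is claimed, and [id] is a default value. *)
  move=> t; have [t0|t0] := boolP (0 <= t); last by exists id, id.
  by have [l [l' ?]] := S_fbm t t0; exists l, l'.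
have l_creation t : 0 <= t -> left_creation tens (interval_L2 t) (l t).
  by move=> /lP[].
have l'_bounded t : 0 <= t -> bounded_operator (l' t) by move=> /lP[].
have l_adjoint t : 0 <= t -> adjoint ip (l t) (l' t) by move=> /lP[].
have SE t x : 0 <= t -> S t x = l t x + l' t x by move=> /lP[_ _ _ ->].
have [U [U_linear U_norm U_tens]] := flip_ex fockH.
have UK := U_involutive fockH U_linear U_norm U_tens.
have bU := U_bounded U_linear U_norm.
set X := [set A | _].
have bX A : X A -> bounded_operator A.
  move=> [t t0 ->]; have [[bl _] bl' _ ->] := lP t t0; exact: bounded_add.
have vX := vna_generated ip bX.
split => //; apply/seteqP; split => [Z [XZ ZC]|_ [c ->]]; last first.
  split.
    by have := vna_scale vX c (vna_id vX).
  move=> A XA; apply: boolp.funext => x /=.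
  by rewrite (linZ (vna_bounded vX XA).1).
have bZ := vna_bounded vX XZ.
have ZS t x : 0 <= t -> Z (S t x) = S t (Z x).
  move=> t0; have XS : generated_vna ip X (S t) by apply: sub_generated; exists t.
  exact: (congr1 (fun f => f x) (ZC _ XS)).
pose Sr t x := U (l t (U x) + l' t (U x)).
have bSr t : 0 <= t -> bounded_operator (Sr t).
  move=> t0; have [[bl _] bl' _ _] := lP t t0.
  exact: bounded_comp bU (bounded_comp (bounded_add bl bl') bU).
have ZSr t x : 0 <= t -> Z (Sr t x) = Sr t (Z x).
  move=> t0.
  (* [Z] lies in every von Neumann algebra containing the [S t], in particular in the commutant of
     the right-handed fields. *)
  pose XR := [set A | exists2 t : R, 0 <= t & A = Sr t].
  have vR : von_neumann_algebra ip [set A | bounded_operator A /\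
      forall T, XR T -> forall x, A (T x) = T (A x)].
    apply: vna_commutant => _ [s s0 ->]; split; first exact: bSr.
    exact: (field_selfadjoint fockH l_adjoint U_linear U_norm U_tens s0).
  have [_] : [set A | bounded_operator A /\
      forall T, XR T -> forall x, A (T x) = T (A x)] Z.
    apply: XZ; split => // _ [s s0 ->]; split; first by apply: bX; exists s.
    move=> _ [u u0 ->] y; rewrite !SE//.
    exact: (field_commute fockH l_creation l'_bounded l_adjoint U_linear U_norm U_tens).
  by apply; exists t.
pose vac := tens [::].
have Uvac : U vac = vac by exact: U_tens.
have xiE : Z vac = ip (Z vac) vac *: vac.
  apply: (field_commuting_vector fockH l_creation l'_bounded l_adjoint U_linear U_norm U_tens).
  (* [S t] and [Sr t] send the vacuum to the same one-letter tensor, and [Z] commutes with both. *)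
  move=> t t0; rewrite -SE// -ZS// -/(Sr t (Z vac)) -ZSr// /Sr Uvac SE//.
  rewrite (l'_vac fockH l_creation l_adjoint)// addr0 (l_creation t t0).2 U_tens.
  by [].
exists (ip (Z vac) vac); set c := ip _ _ in xiE *.
have bZc : bounded_operator (fun x => Z x - c *: x).
  by apply: bounded_sub => //; apply: bounded_scale; exact: bounded_id.
(* Conjugation by the flip turns commutation with [Sr] into commutation with the left-handed
   fields. *)
have W0 := vacuum_separating fockH l_creation l'_bounded l_adjoint
  (bounded_comp bU (bounded_comp bZc bU)).
apply: boolp.funext => x; apply/eqP; rewrite -subr_eq0; apply/eqP.
rewrite -[x]UK -[LHS]UK [U (_ - _)]W0 ?(lin0 U_linear)//.
- move=> t t0 y.
  have := ZSr t (U y) t0; rewrite /Sr UK => ZE.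
  have -> : l t y + l' t y = U (Sr t (U y)) by rewrite /Sr !UK.
  rewrite UK ZSr// -(linZ (bSr _ t0).1) -(linB (bSr _ t0).1) /Sr UK.
  by [].
- by rewrite Uvac xiE subrr (lin0 U_linear).
Qed.
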